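(* Let $K$ be a field of prime characteristic $p$ and let $L/K$ be a finite field extension. Then: 1. $L=\big(L/L^{G(L/K)}_{dif}\big)^{pi}\otimes_{L^{G(L/K)}_{dif}}\big(L/L^{G(L/K)}_{dif}\big)^{gal}=L^{G(L/K)}\otimes_{L^{G(L/K)}_{dif}}L_{dif}$. 2. $\big(L/L^{G(L/K)}_{dif}\big)^{pi}=L^{G\left(L/L^{G(L/K)}_{dif}\right)}=L^{G(L/K)}$. 3. $\big(L/L^{G(L/K)}_{dif}\big)^{gal}=\big(L/L^{G(L/K)}_{dif}\big)^{sep}=\big(L/L^{G(L/K)}_{dif}\big)_{dif}=L_{dif}$.
   Context: For a finite field extension $L/K$: $G(L/K)=\mathrm{Aut}_{K\text{-alg}}(L)$ and $L^{G(L/K)}$ is its fixed field. $\mathcal{D}(L/K)=\bigcup_{i\ge0}\mathcal{D}_i\subseteq\mathrm{End}_K(L)$ is the algebra of $K$-linear differential operators on $L$, where $\mathcal{D}_0=L$ (acting by multiplication) and $\mathcal{D}_i=\{\delta\in\mathrm{End}_K(L)\mid\delta l-l\delta\in\mathcal{D}_{i-1}\text{ for all }l\in L\}$. $L_{dif}=(L/K)_{dif}=\{l\in L\mid l\delta=\delta l\text{ for all }\delta\in\mathcal{D}(L/K)\}$ and $L^{G(L/K)}_{dif}:=L^{G(L/K)}\cap L_{dif}$. For an intermediate field $F$, $(L/F)^{pi}$, $(L/F)^{sep}$, $(L/F)^{gal}$ are the largest purely inseparable, separable, Galois subfields of the extension $L/F$, and $(L/F)_{dif}=\{l\in L\mid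 l\delta=\delta l\text{ for all }\delta\in\mathcal{D}(L/F)\}$. For subfields $M,N\supseteq F$ of $L$, ''$L=M\otimes_F N$'' means that the multiplication map $M\otimes_F N\to L$ is an isomorphism. *)

(* Defs.v *)
From HB Require Import structures.
From mathcomp Require Import all_boot all_order all_algebra all_field.
From mathcomp Require Import generic_quotient.
From mathcomp Require Import boolp classical_sets.

Set Implicit Arguments.
Unset Strict Implicit.
Unset Printing Implicit Defensive.
Import GRing.Theory.
Local Open Scope ring_scope.
Local Open Scope quotient_scope.

(** Throughout, intermediate fields of a finite extension [L/K] are elements of
    [{subfield L}], and [1%AS] is the image of [K] in [L]. *)

Section Comprehension.
Variables (K : fieldType) (L : fieldExtType K).
Implicit Types (M E : {subfield L}) (P : L -> Prop).

(** The subfield whose elements are exactly those satisfying [P]; the default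
    value [1%AS] is irrelevant when [P] is closed (see [subfield_ofP]). *)
Definition subfield_of P : {subfield L} :=
  xget 1%AS (fun M => forall x, x \in M <-> P x).

Lemma subfield_ofP P : P 1 ->
    (forall (a : K) x y, P x -> P y -> P (a *: x + y)) ->
    (forall x y, P x -> P y -> P (x * y)) ->
  forall x, x \in subfield_of P <-> P x.
Proof.
move=> P1 PD PM.
pose below (U : {vspace L}) := forall x, x \in U -> P x.
have P0 : P 0 by have := PD (-1) _ _ P1 P1; rewrite scaleN1r addNr.
have [U [Ub Umax]] : exists U, below U /\
    forall V, below V -> (\dim V <= \dim U)%N.
  pose d n := `[< exists2 U, below U & \dim U = n >].
  have dex : exists n, d n.
    by exists 0%N; apply/asboolP; exists 0%VS; rewrite ?dimv0 // => x;
       rewrite memv0 => /eqP ->.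
  have dub n : d n -> (n <= \dim {:L})%N.
    by case/asboolP => U _ <-; rewrite dimvS ?subvf.
  case: (ex_maxnP dex dub) => n /asboolP[U Ub Un] nmax; exists U; split=> //.
  by move=> V Vb; rewrite Un; apply: nmax; apply/asboolP; exists V.
have UP x : x \in U <-> P x.
  split=> [|Px]; first exact: Ub.
  have Vb : below (<[x]> + U)%VS.
    move=> _ /memv_addP[_ /vlineP[a ->] [u /Ub Pu ->]]; exact: PD.
  have /eqP -> : (U == <[x]> + U)%VS by rewrite eqEdim addvSr Umax.
  by rewrite (subvP (addvSl _ _)) ?memv_line.
have Ualg : is_aspace U.
  rewrite /is_aspace has_algid1 ?UP //=; apply/prodvP => x y /UP Px /UP Py.
  by apply/UP; apply: PM.
have /(xgetPex 1%AS) : exists M : {subfield L}, forall x, x \in M <-> P x.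
  by exists (ASpace Ualg).
by [].
Qed.

End Comprehension.

Section SubfieldConstructions.
Variables (K : fieldType) (L : fieldExtType K).
Implicit Types (F M N E : {subfield L}).

(** The fixed field of [G(L/F)]. *)
Definition fixedG F : {subfield L} :=
  subfield_of (fun x => forall s : 'End(L), kAut F {:L} s -> s x = x).

Lemma fixedGP F x :
  x \in fixedG F <-> forall s : 'End(L), kAut F {:L} s -> s x = x.
Proof.
apply: subfield_ofP => {x} [s|a x y Px Py s ks|x y Px Py s ks].
- by case/andP=> /kHomP_tmp[s1 _] _; rewrite s1 ?mem1v.
- by rewrite linearP /= (Px s ks) (Py s ks).
- by case/andP: (ks) => /kHomP_tmp[_ sM] _; rewrite sM ?memvf // (Px s ks) (Py s ks).
Qed.

(** [diffop F i d] means [d] belongs to the [i]-th term of the order filtration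
    of the algebra of [F]-linear differential operators on [L]. *)
Fixpoint diffop F (i : nat) (d : 'End(L)) : Prop :=
  if i is j.+1 then
    (forall a x, a \in F -> d (a * x) = a * d x) /\
    (forall l : L, diffop F j ((d \o amull l) - (amull l \o d))%VF)
  else exists l : L, d = amull l.

Definition difField F : {subfield L} :=
  subfield_of (fun x => forall i (d : 'End(L)), diffop F i d ->
    (amull x \o d = d \o amull x)%VF).

Lemma difFieldP F x : x \in difField F <->
  forall i (d : 'End(L)), diffop F i d -> (amull x \o d = d \o amull x)%VF.
Proof.
apply: subfield_ofP => {x} [i d _|a x y Px Py i d Dd|x y Px Py i d Dd].
- by apply/lfunP=> z; rewrite !lfunE /= !lfunE /= !mul1r.
- have /lfunP Qx := Px _ _ Dd; have /lfunP Qy := Py _ _ Dd.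
  apply/lfunP=> z; have := Qx z; have := Qy z.
  rewrite !lfunE /= !lfunE /= => Ey Ex.
  by rewrite !mulrDl -!scalerAl linearP Ex Ey.
- have /lfunP Qx := Px _ _ Dd; have /lfunP Qy := Py _ _ Dd.
  apply/lfunP=> z; have := Qx (y * z); have := Qy z.
  by rewrite !lfunE /= !lfunE /= -!mulrA => -> ->.
Qed.

Section Largest.
Variable P : {subfield L} -> {subfield L} -> Prop.

Definition is_largest F M : Prop :=
  [/\ (F <= M)%VS, P F M &
      forall E, (F <= E)%VS -> P F E -> (E <= M)%VS].

Definition largest F : {subfield L} := xget F (is_largest F).

Lemma largestP F : (exists M, is_largest F M) -> is_largest F (largest F).
Proof. exact: xgetPex. Qed.

Lemma is_largest_uniq F M N : is_largest F M -> is_largest F N -> M = N.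
Proof.
move=> [FM PM Mmax] [FN PN Nmax]; apply/val_inj/eqP.
by rewrite eqEsubv; apply/andP; split; [apply: Nmax | apply: Mmax].
Qed.

End Largest.

(** [normal_over F M] and [galois_over F M] are [normalField F M] and [galois F M] of
    the library, which are only available there when [L] is a splitting field
    (see [galois_overE]). *)
Definition normal_over F M : Prop :=
  forall x, x \in M -> exists2 r : seq L,
    all [in M] r & minPoly F x = \prod_(y <- r) ('X - y%:P).

Definition galois_over F M : Prop := separable F M /\ normal_over F M.

Definition pi_part : {subfield L} -> {subfield L} :=
  largest (fun F M => purely_inseparable F M).
Definition sep_part : {subfield L} -> {subfield L} :=
  largest (fun F M => separable F M).
Definition gal_part : {subfield L} -> {subfield L} := largest galois_over.

Lemma pi_partP F : is_largest (fun F M => purely_inseparable F M) F (pi_part F).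
Proof.
apply: largestP; pose P x : Prop := purely_inseparable_element F x.
have PP x : x \in subfield_of P <-> P x.
  apply: subfield_ofP => {x} [|a x y Px Py|x y].
  - by apply: base_inseparable; rewrite mem1v.
  - apply: inseparable_add => //; rewrite -mulr_algl.
    case/purely_inseparable_elementP_pchar: Px => n nn xn.
    apply/purely_inseparable_elementP_pchar; exists n => //.
    by rewrite exprMn; apply: rpredM => //; apply/rpredX/memvZ/mem1v.
  - case/purely_inseparable_elementP_pchar=> n nn xn.
    case/purely_inseparable_elementP_pchar=> m mm ym.
    apply/purely_inseparable_elementP_pchar; exists (n * m)%N.
      by rewrite pnatM nn.
    by rewrite exprMn; apply: rpredM; [|rewrite mulnC]; rewrite exprM; apply: rpredX.
exists (subfield_of P); split.
- by apply/subvP=> x Fx; apply/PP; apply: base_inseparable.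
- by apply/purely_inseparableP=> x /PP.
- by move=> E _ /purely_inseparableP FE; apply/subvP=> x /FE /PP.
Qed.

Lemma sep_partP F : is_largest (fun F M => separable F M) F (sep_part F).
Proof.
apply: largestP; exists <<F; separable_generator F {:L}>>%AS; split.
- exact: subv_adjoin.
- by rewrite -adjoin_separable_eq separable_generatorP.
- move=> E _ /separableP sE; apply/subvP=> x Ex.
  rewrite -separable_inseparable_element.
  have /purely_inseparableP-> := separable_generator_maximal {:L} F; last exact: memvf.
  by rewrite (separable_elementS _ (sE _ Ex)) // subv_adjoin.
Qed.

(** Splitting fields are normal, inside an arbitrary finite extension. *)
Lemma splitting_normal F (p : {poly L}) (r : seq L) :
    p \is a polyOver F -> p %= \prod_(y <- r) ('X - y%:P) ->
  normal_over F <<F & r>>%AS.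
Proof.
move=> Fp Dp x Ex; set E := <<F & r>>%AS in Ex *.
have sFE : (F <= E)%VS := subv_adjoin_seq F r.
have rE y : y \in r -> y \in E by move=> ry; apply: seqv_sub_adjoin.
pose E' : {subfield fieldOver F} := aspaceOver F E.
have E'E : E' =i E := mem_aspaceOver sFE.
pose T : fieldExtType (subvs_of F) := subvs_of E'.
pose v : {rmorphism T -> L} := (vsval : T -> fieldOver F).
have v_inj : injective v := fmorph_inj v.
have v_alg (k : subvs_of F) : v (in_alg T k) = vsval k.
  by rewrite /v /= algid1 fieldOver_scaleE mulr1.
have v_algP (q : {poly subvs_of F}) :
    map_poly v (map_poly (in_alg T) q) = map_poly vsval q.
  by rewrite -map_poly_comp; apply: eq_map_poly => k /=; apply: v_alg.
have v_prod (s : seq T) : map_poly v (\prod_(y <- s) ('X - y%:P)) =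
    \prod_(y <- map v s) ('X - y%:P).
  rewrite rmorph_prod big_map; apply: eq_bigr => y _.
  by rewrite /= map_polyXsubC.
have v_onto y : y \in E -> {u : T | v u = y}.
  by rewrite -E'E => yE'; exists (Subvs yE').
have splitT : splitting_field_axiom T.
  have [q Dq] := polyOver_subvs Fp.
  exists (map_poly (in_alg T) q); first by apply/polyOver1P; exists q.
  have [r' Dr'] : {r' | map v r' = r}.
    elim: (r) rE => [|y t IHt] rE; first by exists [::].
    have [|t' Dt'] := IHt; first by move=> z zt; apply: rE; rewrite inE zt orbT.
    have [u Du] := v_onto y (rE y (mem_head _ _)).
    by exists (u :: t'); rewrite /= Du Dt'.
  exists r'; first by rewrite -(eqp_map v) v_algP -Dq v_prod Dr'.
  pose W : {subfield T} := <<1 & r'>>%AS.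
  pose P y := exists2 w, w \in W & v w = y.
  have PP y : y \in subfield_of P <-> P y.
    apply: subfield_ofP => {y} [|a y z [w Ww <-] [t Wt <-]|y z [w Ww <-] [t Wt <-]].
    - by exists 1; rewrite ?mem1v ?rmorph1.
    - have aF : a%:A \in F by rewrite memvZ ?mem1v.
      exists (in_alg T (Subvs aF) * w + t).
        by rewrite memvD // memvM // memvZ ?mem1v.
      by rewrite rmorphD rmorphM v_alg /= mulr_algl.
    - by exists (w * t); rewrite ?memvM ?rmorphM.
  have sEP : (E <= subfield_of P)%VS.
    apply/Fadjoin_seqP; split.
      apply/subvP=> y Fy; apply/PP; exists (in_alg T (Subvs Fy)); last exact: v_alg.
      by rewrite memvZ ?mem1v.
    move=> y; rewrite -Dr' => /mapP[u ur' ->]; apply/PP; exists u => //.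
    exact: seqv_sub_adjoin.
  apply/vspaceP=> u; rewrite memvf.
  have : v u \in E by rewrite -E'E; apply: valP.
  by move/(subvP sEP)/PP=> [w Ww /v_inj <-].
pose mT := FieldExt_isSplittingField.Build _ T splitT.
pose T' : splittingFieldType (subvs_of F) := HB.pack (FieldExt.sort T) mT.
have [u Du] := v_onto x Ex.
have [s /eqP Ds] := @splitting_field_normal _ T' 1%AS u.
have dv : minPoly F x %| \prod_(y <- map v s) ('X - y%:P).
  have /polyOver1P[q Dq] : minPoly 1 (u : T) \is a polyOver 1%VS.
    exact: (minPolyOver 1%AS).
  rewrite -v_prod -Ds Dq v_algP; apply: minPoly_dvdp.
    by apply/polyOver_subvs; exists q.
  by rewrite -v_algP -Dq -Du fmorph_root (@root_minPoly _ T' 1%AS).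
have [m Dm] := dvdp_prod_XsubC dv.
exists (mask m (map v s)).
  by apply/allP=> y /mem_mask/mapP[w _ ->]; rewrite -E'E; apply: valP.
by apply/eqP; rewrite -eqp_monic ?monic_minPoly ?monic_prod_XsubC.
Qed.

Lemma gal_partP F : is_largest galois_over F (gal_part F).
Proof.
apply: largestP.
have galF : galois_over F F.
  split=> [|x Fx]; first exact: separable_refl.
  by exists [:: x]; rewrite /= ?Fx // big_seq1; apply/minPoly_XsubC.
have gen M : (F <= M)%VS -> galois_over F M -> exists r : seq L,
    [/\ (M <= <<F & r>>)%VS, all (separable_element F) r &
        exists2 p, p \is a polyOver F & p = \prod_(y <- r) ('X - y%:P)].
  move=> sFM [sM nM]; pose t := separable_generator F M.
  have tM : t \in M := separable_generator_mem M F.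
  have [r rM Dr] := nM _ tM; exists r; split.
  - apply: (subv_trans (sub_adjoin_separable_generator sM)); rewrite -/t.
    apply/FadjoinP; split; first exact: subv_adjoin_seq.
    by apply: seqv_sub_adjoin; rewrite -root_prod_XsubC -Dr root_minPoly.
  - by apply/allP=> y /(allP rM)/(separableP sM).
  - by exists (minPoly F t); rewrite ?minPolyOver.
have join M N : (F <= M)%VS -> galois_over F M -> (F <= N)%VS ->
    galois_over F N -> exists E : {subfield L},
      [/\ (M <= E)%VS, (N <= E)%VS & galois_over F E].
  move=> sFM gM sFN gN; have [r [sMr sepr [p Fp Dp]]] := gen M sFM gM.
  have [t [sNt sept [q Fq Dq]]] := gen N sFN gN.
  exists <<F & r ++ t>>%AS; split.
  - by apply: subv_trans sMr _; apply: adjoin_seqSr => y; rewrite mem_cat => ->.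
  - by apply: subv_trans sNt _; apply: adjoin_seqSr => y; rewrite mem_cat orbC => ->.
  - split; first by apply: separable_Fadjoin_seq; rewrite all_cat sepr.
    apply: (@splitting_normal F (p * q)); first exact: rpredM.
    by rewrite big_cat /= Dp Dq eqpxx.
pose d n := `[< exists M : {subfield L},
  [/\ (F <= M)%VS, galois_over F M & \dim M = n] >].
have dex : exists n, d n by exists (\dim F); apply/asboolP; exists F; split.
have dub n : d n -> (n <= \dim {:L})%N.
  by case/asboolP => U [_ _ <-]; rewrite dimvS ?subvf.
case: (ex_maxnP dex dub) => n /asboolP[M [sFM gM Mn]] nmax; exists M; split=> //.
move=> N sFN gN; have [E [sME sNE gE]] := join M N sFM gM sFN gN.
suff /eqP-> : (M == E :> {vspace L})%VS by [].
rewrite eqEdim sME Mn; apply: nmax; apply/asboolP; exists E; split=> //.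
exact: subv_trans sFM sME.
Qed.

End SubfieldConstructions.

Lemma galois_overE (K : fieldType) (L : splittingFieldType K)
    (F M : {subfield L}) : (F <= M)%VS -> galois_over F M <-> galois F M.
Proof.
move=> sFM; rewrite /galois sFM /=; split.
- by case=> -> nM; apply/normalFieldP.
- by case/andP=> sM /normalFieldP nM; split.
Qed.

Section Tensor.
Variables (K : fieldType) (L : fieldExtType K) (F M N : {subfield L}).

(** The tensor product of [F]-modules, constructed as the free commutative monoid
    on pairs modulo biadditivity and balancedness.  The rule [teq0] is what
    makes the quotient monoid a group. *)
Definition formal : Type := seq (subvs_of M * subvs_of N).

Inductive teq : formal -> formal -> Prop :=
| teq_refl s : teq s s
| teq_sym s t : teq s t -> teq t s
| teq_trans s t u : teq s t -> teq t u -> teq s u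
| teq_cat s1 t1 s2 t2 : teq s1 t1 -> teq s2 t2 -> teq (s1 ++ s2) (t1 ++ t2)
| teq_catC s t : teq (s ++ t) (t ++ s)
| teq0 n : teq [:: (0, n)] [::]
| teqDl m1 m2 n : teq [:: (m1 + m2, n)] [:: (m1, n); (m2, n)]
| teqDr m n1 n2 : teq [:: (m, n1 + n2)] [:: (m, n1); (m, n2)]
| teqZ (a : L) m m' n n' : a \in F ->
    vsval m' = a * vsval m -> vsval n' = a * vsval n ->
    teq [:: (m', n)] [:: (m, n')].

Definition teqb (s t : formal) : bool := `[< teq s t >].

Lemma teqb_refl : reflexive teqb.
Proof. by move=> s; apply/asboolP; apply: teq_refl. Qed.
Lemma teqb_sym : symmetric teqb.
Proof. by move=> s t; apply/asboolP/asboolP; apply: teq_sym. Qed.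
Lemma teqb_trans : transitive teqb.
Proof.
by move=> t s u /asboolP st /asboolP tu; apply/asboolP; apply: teq_trans tu.
Qed.

Canonical teqb_equiv := EquivRel teqb teqb_refl teqb_sym teqb_trans.

Definition tensor : Type := {eq_quot teqb}.

Definition formal_mul (s : formal) : L := \sum_(x <- s) vsval x.1 * vsval x.2.

Definition tensor_mul (t : tensor) : L := formal_mul (repr t).

Lemma teq_mul s t : teq s t -> formal_mul s = formal_mul t.
Proof.
rewrite /formal_mul; elim=> {s t} //.
- by move=> s t u _ -> _ ->.
- by move=> s1 t1 s2 t2 _ e1 _ e2; rewrite !big_cat /= e1 e2.
- by move=> s t; rewrite !big_cat /= addrC.
- by move=> n; rewrite big_seq1 big_nil mul0r.
- by move=> m1 m2 n; rewrite !big_cons !big_nil !addr0 mulrDl.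
- by move=> m n1 n2; rewrite !big_cons !big_nil !addr0 mulrDr.
- by move=> a m m' n n' _ em en; rewrite !big_seq1 /= em en mulrCA mulrA.
Qed.

Lemma tensor_mul_pi (s : formal) : tensor_mul (\pi s) = formal_mul s.
Proof.
apply: teq_mul; apply/asboolP; rewrite -[`[< _ >]]/(teqb_equiv _ _).
by apply/eqmodP; rewrite reprK.
Qed.

(** [L = M (x)_F N]: the multiplication map is an isomorphism.  It is a
    morphism by construction (see [tensor_mul_pi]). *)
Definition is_tensor_decomposition : Prop :=
  [/\ (F <= M)%VS, (F <= N)%VS & bijective tensor_mul].

End Tensor.

(* Main.v *)
(** Let [S] be the separable closure of a field [F] in [L].  An element separable over [F]
    commutes with every differential operator, while [L/S] is purely inseparable,
    so that every [ad l] is nilpotent on [S]-linear maps and all of these are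
    differential operators; hence [difField F = S].  The orbit polynomials of
    [G(L/F)] show that [L] is separable over [M = fixedG F] and that [S] is Galois
    over [M :&: S]; moreover [M] is purely inseparable over [M :&: S].  As [L] is
    both separable and purely inseparable over [M * S], it equals [M * S].
    Finally, write [S = (M :&: S)(t)]: normality gives [t] the same minimal
    polynomial over [M] as over [M :&: S], so the powers of [t] form a basis of
    [L] over [M], and [M (x) S -> L] is injective. *)
Require Import Defs.
From HB Require Import structures.
From mathcomp Require Import all_boot all_order all_algebra all_field.
From mathcomp Require Import generic_quotient boolp.
From mathcomp Require Import ring.

Set Implicit Arguments.
Unset Strict Implicit.
Unset Printing Implicit Defensive.
Import GRing.Theory.
Local Open Scope ring_scope.

(** * The separable closure of a subfield in [L] *)

Section SeparablePart.
Variables (K : fieldType) (L : fieldExtType K).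
Implicit Types (F E M : {subfield L}) (x : L).

Lemma sub_sep_part F : (F <= sep_part F)%VS.
Proof. by have [] := sep_partP F. Qed.

Lemma mem_sep_part F x : (x \in sep_part F) = separable_element F x.
Proof.
have [_ /separableP sepS maxS] := sep_partP F.
apply/idP/idP=> [/sepS // | sepx].
apply: (subvP (maxS <<F; x>>%AS _ _)); first exact: subv_adjoin.
  by rewrite -adjoin_separable_eq.
exact: memv_adjoin.
Qed.

(** Transitivity: [E] is separable over [F], so separable elements over [E] are separable over
    [F]. *)
Lemma sep_part_id F E :
  (F <= E)%VS -> (E <= sep_part F)%VS -> sep_part E = sep_part F.
Proof.
move=> sFE sES; apply/val_inj/eqP; rewrite eqEsubv; apply/andP; split.
  have sepE : separable F E.
    by apply/separableP=> y /(subvP sES); rewrite mem_sep_part.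
  apply/subvP=> x; rewrite !mem_sep_part => sepx.
  have sepEx : separable E <<E; x>> by rewrite -adjoin_separable_eq.
  have /separableP := separable_trans sepE sepEx.
  by apply; apply: memv_adjoin.
by apply/subvP=> x; rewrite !mem_sep_part; apply: separable_elementS.
Qed.

Lemma exp_sep_part F x :
  exists2 n, [pchar L].-nat n & x ^+ n \in sep_part F.
Proof.
have [n /andP[chn sepn]] := separable_exponent_pchar F x.
by exists n; rewrite ?mem_sep_part.
Qed.

End SeparablePart.

(** * Brackets, differential operators and their commutant *)

Section DifferentialOperators.
Variables (K : fieldType) (L : fieldExtType K).
Implicit Types (F : {subfield L}) (d : 'End(L)) (x y z l : L).

(** Convertible to the bracket in [diffop], so brackets can be folded into [ad]. *)
Definition ad l d : 'End(L) := ((d \o amull l) - (amull l \o d))%VF.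

Lemma adE l d z : ad l d z = d (l * z) - l * d z.
Proof. by rewrite /ad lfunE /= opp_lfunE !comp_lfunE !lfunE. Qed.

Lemma adC x y d : ad x (ad y d) = ad y (ad x d).
Proof. by apply/lfunP=> z; rewrite !adE (mulrCA x y z); ring. Qed.

Lemma ad_is_linear l : linear (ad l).
Proof.
move=> a d d'; apply/lfunP=> z; rewrite adE [RHS]add_lfunE scale_lfunE !adE.
by rewrite !add_lfunE !scale_lfunE mulrDr -scalerAr scalerBr opprD addrACA.
Qed.

HB.instance Definition _ l :=
  GRing.isLinear.Build K 'End(L) 'End(L) _ (ad l) (ad_is_linear l).

Lemma ad_linearl d : linear (ad^~ d).
Proof.
move=> a x y; apply/lfunP=> z; rewrite adE [RHS]add_lfunE scale_lfunE !adE.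
by rewrite !mulrDl -!scalerAl linearP scalerBr opprD addrACA.
Qed.

(** Reduces brackets with arbitrary [l] to finitely many, those with basis vectors. *)
Lemma ad_vbasis l d :
  ad l d = \sum_i coord (vbasis {:L}) i l *: ad (vbasis {:L})`_i d.
Proof.
pose lin := GRing.isLinear.Build K L 'End(L) _ (ad^~ d) (ad_linearl d).
pose adr : {linear L -> 'End(L)} := HB.pack (ad^~ d) lin.
rewrite {1}(coord_vbasis (memvf l)) -[LHS]/(adr _) linear_sum.
by apply: eq_bigr => i _; rewrite linearZ.
Qed.

Lemma iter_adC n x y d : iter n (ad x) (ad y d) = ad y (iter n (ad x) d).
Proof. by elim: n => //= n ->; rewrite adC. Qed.

(** Multiplying by [l] before and after [d] are commuting operations; with 'X for the former, [ad l]
    acts as 'X - l, and its iterates as powers of this polynomial. *)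
Lemma iter_adE n l d z : iter n (ad l) d z =
  \sum_(i < n.+1) (('X - l%:P) ^+ n)`_i * d (l ^+ i * z).
Proof.
elim: n z => [|n IHn] z.
  by rewrite big_ord1 expr0 coef1 !mul1r.
rewrite /= adE !IHn; set P := ('X - l%:P) ^+ n.
have coefP i : (('X - l%:P) ^+ n.+1)`_i =
    (if i is j.+1 then P`_j else 0) - P`_i * l.
  by rewrite exprSr mulrBr coefB coefMX coefMC; case: i.
have Pn : P`_n.+1 = 0 by rewrite nth_default // size_exp_XsubC.
under [RHS]eq_bigr do rewrite coefP mulrBl.
rewrite sumrB; congr (_ - _).
  rewrite [RHS]big_ord_recl /= mul0r add0r; apply: eq_bigr => i _.
  by rewrite mulrA -exprSr.
rewrite [RHS]big_ord_recr /= Pn !mul0r addr0 mulr_sumr; apply: eq_bigr => i _.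
by rewrite mulrCA mulrA.
Qed.

(* In characteristic p, ad(l)^n = ad(l^n) for n a power of p. *)
Lemma iter_ad_pchar n l d :
  [pchar L].-nat n -> (forall z, d (l ^+ n * z) = l ^+ n * d z) ->
  iter n (ad l) d = 0.
Proof.
move=> chn dln; apply/lfunP=> z; rewrite iter_adE lfunE /=.
have chn' : [pchar {poly L}].-nat n by apply: sub_in_pnat chn => q _; rewrite pchar_poly.
rewrite exprDn_pchar // exprNn_pchar // -polyC_exp.
case: n chn {chn'} dln => // n _ dln.
rewrite big_ord_recl big_ord_recr /= big1 ?add0r => [|i _].
  rewrite !coefB !coefXn !coefC /= eqxx subr0 mul1r /bump add1n sub0r.
  by rewrite mul1r dln mulNr addNr.
by rewrite !coefB !coefXn !coefC /= /bump add1n eqSS ltn_eqF ?subr0 ?mul0r.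
Qed.

Lemma diffop_linear F i d : diffop F i d ->
  forall a x, a \in F -> d (a * x) = a * d x.
Proof.
case: i => [[l ->] a x _ | i []] //.
by rewrite !lfunE /= mulrCA.
Qed.

Lemma diffopP F i d (a : K) d' :
  diffop F i d -> diffop F i d' -> diffop F i (a *: d + d').
Proof.
elim: i d d' => [|i IHi] d d'.
  by move=> [l ->] [l' ->]; exists (a *: l + l'); rewrite linearP.
move=> [dF dD] [dF' dD']; split=> [b x bF|l].
  by rewrite !add_lfunE !scale_lfunE dF // dF' // mulrDr scalerAr.
rewrite -[X in diffop _ _ X]/(ad l _) linearP.
by apply: IHi; [apply: dD | apply: dD'].
Qed.

Lemma diffop0 F i : diffop F i 0.
Proof.
elim: i => [|i IHi]; first by exists 0; rewrite linear0.
split=> [a x _|l]; first by rewrite !lfunE /= mulr0.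
by rewrite -[X in diffop _ _ X]/(ad l _) linear0.
Qed.

Lemma diffop_sum F i (I : Type) (r : seq I) (c : I -> K) (d_ : I -> 'End(L)) :
  (forall j, diffop F i (d_ j)) -> diffop F i (\sum_(j <- r) c j *: d_ j).
Proof.
move=> Dd; elim: r => [|j r IHr]; first by rewrite big_nil; apply: diffop0.
by rewrite big_cons; apply: diffopP.
Qed.

Lemma ad_flinear F l d : (forall a x, a \in F -> d (a * x) = a * d x) ->
  forall a x, a \in F -> ad l d (a * x) = a * ad l d x.
Proof. by move=> dF a x Fa; rewrite !adE (mulrCA l a x) !(dF a) //; ring. Qed.

(* Each bracket with a basis vector [e_i] uses up one unit of the budget [b i]. *)
Lemma nilpotent_diffop F d (b : 'I_(\dim {:L}) -> nat) :
  (forall a x, a \in F -> d (a * x) = a * d x) ->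
  (forall i, iter (b i) (ad (vbasis {:L})`_i) d = 0) ->
  diffop F (\sum_i b i)%N d.
Proof.
move: {2}(\sum_i b i)%N (erefl (\sum_i b i)%N) => n.
elim: n b d => [|n IHn] b d sumb dF nil_d.
  (* As [L] is nonzero there is some index, and a zero budget there forces [d = 0]. *)
  have i0 : 'I_(\dim {:L}) := Ordinal (adim_gt0 _).
  move/eqP: sumb; rewrite sum_nat_eq0 => /forallP/(_ i0)/eqP b0.
  by have := nil_d i0; rewrite b0 /= => ->; apply: diffop0.
rewrite sumb; split=> // l; rewrite -[X in diffop _ _ X]/(ad l d) ad_vbasis.
apply: diffop_sum => i /=.
have [bi0|bi_gt0] := posnP (b i).
  by have := nil_d i; rewrite bi0 /= => ->; rewrite linear0; apply: diffop0.
pose b' j := (b j - (j == i))%N.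
have sumb' : (\sum_j b' j = n)%N.
  move: sumb; rewrite (bigD1 i) //= => sumb.
  rewrite /b' (bigD1 i) //= eqxx.
  under eq_bigr => j /negPf-> do rewrite subn0.
  by apply: succn_inj; rewrite -sumb -addSn subn1 prednK.
rewrite -sumb'; apply: IHn => //; first exact: ad_flinear.
move=> j; rewrite /b'; have [->|ji] := eqVneq j i.
  by rewrite -iterSr subn1 prednK.
by rewrite subn0 iter_adC nil_d linear0.
Qed.

(** Each basis vector has a p-power exponent [n] whose power lies in [sep_part F], hence commutes
    with [d]; so its bracket is nilpotent on [d]. *)
Lemma sep_part_linear_diffop F d :
    (forall a x, a \in sep_part F -> d (a * x) = a * d x) ->
  exists i, diffop F i d.
Proof.
move=> dS.
have [b Db] : exists b : 'I_(\dim {:L}) -> nat, forall i,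
    iter (b i) (ad (vbasis {:L})`_i) d = 0.
  have /choice[b bP] i : exists n, iter n (ad (vbasis {:L})`_i) d = 0.
    have [n chn Sn] := exp_sep_part F (vbasis {:L})`_i.
    by exists n; apply: iter_ad_pchar => // z; apply: dS.
  by exists b.
exists (\sum_i b i)%N; apply: nilpotent_diffop => // a x Fa.
by apply: dS; apply: (subvP (sub_sep_part F)).
Qed.

(* If f is the minimal polynomial of [x], then 0 = d (f(x) z) = f'(x) [d, x] z,
   provided that [x] commutes with [d, x]. *)
Lemma separable_diffop_comm F x i d : separable_element F x ->
  diffop F i d -> forall z, d (x * z) = x * d z.
Proof.
move=> sepx; elim: i d => [|i IHi] d Dd z.
  by case: Dd => l ->; rewrite !lfunE /= mulrCA.
have dF := diffop_linear Dd; have [_ /(_ x)/IHi/= adx] := Dd.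
rewrite -/(ad x d) in adx.
have dp (f : {poly L}) y : f \is a polyOver F ->
    d (f.[x] * y) = f.[x] * d y + f^`().[x] * ad x d y.
  move=> Ff; elim/poly_ind: f Ff y => [|f c IHf] /polyOverP FfXc y.
    by rewrite deriv0 horner0 !mul0r addr0 linear0.
  have Fc : c \in F by have := FfXc 0; rewrite coefD coefMX coefC /= add0r.
  have Ff : f \is a polyOver F.
    apply/polyOverP=> j; have := FfXc j.+1.
    by rewrite coefD coefMX coefC /= addr0.
  rewrite derivD derivC addr0 derivM derivX mulr1 !hornerE !mulrDl linearD /=.
  have dxy : d (x * y) = x * d y + ad x d y by rewrite adE addrC subrK.
  by rewrite (dF c) // -(mulrA f.[x] x y) IHf // adx dxy; ring.
have := dp (minPoly F x) z (minPolyOver F x).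
rewrite minPolyxx !mul0r linear0 add0r => /esym/eqP.
rewrite mulf_eq0 -/(root _ x).
have := separable_root_der F x; rewrite sepx /= => /negPf-> /=.
by rewrite adE subr_eq0 => /eqP.
Qed.

Lemma difField_sep_part F : difField F = sep_part F.
Proof.
apply/val_inj/vspaceP=> x; apply/idP/idP=> [/difFieldP xD | ]; last first.
  rewrite mem_sep_part => sepx; apply/difFieldP=> i d Dd; apply/lfunP=> z.
  by rewrite !lfunE /= !lfunE /= (separable_diffop_comm sepx Dd).
apply: contraT => xS; set S := sep_part F in xS.
(* An [S]-linear projection onto [S] maps 1 to 1, and [x] into [S]. *)
pose pr : 'End(fieldOver S) := projv <[1 : fieldOver S]>%VS.
have prS a y : a \in S -> pr (a * y) = a * pr y.
  have prZ (c : subvs_of S) (u : fieldOver S) : pr (c *: u) = c *: pr u.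
    exact: linearZ.
  by move=> aS; have := prZ (Subvs aS) y; rewrite !fieldOver_scaleE.
(* [pr] is linear over [S] by construction; viewing it in 'End(L) requires linearity over [K], whose
   image lies in [S]. *)
have pr_lin : linear (pr : L -> L).
  move=> a y z; rewrite [LHS](raddfD pr) /= -mulr_algl prS ?mulr_algl //.
  by rewrite memvZ ?mem1v.
pose mpr := GRing.isLinear.Build K L L _ (pr : L -> L) pr_lin.
pose lpr : {linear L -> L} := HB.pack (pr : L -> L) mpr.
pose d := linfun lpr.
have dS a y : a \in S -> d (a * y) = a * d y.
  by rewrite !lfunE; apply: prS.
have [i Dd] := sep_part_linear_diffop dS.
have d1 : d 1 = 1 by rewrite lfunE; apply: (projv_id (memv_line (1 : fieldOver S))).
have /lfunP/(_ 1) := xD i d Dd.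
have -> : (amull x \o d)%VF 1 = x by rewrite comp_lfunE d1 lfunE /= mulr1.
have -> : (d \o amull x)%VF 1 = pr x.
  by rewrite comp_lfunE [amull x 1]lfunE /= mulr1 lfunE.
have /vlineP[a ->] : pr x \in <[1 : fieldOver S]>%VS by apply: memv_proj.
rewrite fieldOver_scaleE mulr1 => Dx.
by rewrite Dx subvsP in xS.
Qed.

End DifferentialOperators.

(** Take a duplicate-free list of elements satisfying [P] of maximal length; the length is bounded
    because [p] has finitely many roots. *)
Lemma enum_root_subset (R : idomainType) (p : {poly R}) (P : R -> Prop) :
    p != 0 -> (forall x, P x -> root p x) ->
  exists2 r : seq R, uniq r & forall x, x \in r <-> P x.
Proof.
move=> p0 rootP.
pose n_ok n := `[< exists r : seq R,
  [/\ uniq r, forall x, x \in r -> P x & size r = n] >].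
have ex_ok : exists n, n_ok n by exists 0%N; apply/asboolP; exists [::]; split.
have ub_ok n : n_ok n -> (n <= size p)%N.
  case/asboolP=> r [Ur rP <-]; apply/ltnW/max_poly_roots => //.
  by apply/allP=> x /rP/rootP.
case: (ex_maxnP ex_ok ub_ok) => n /asboolP[r [Ur rP sz_r]] max_n.
exists r => // x; split=> [/rP // | Px]; apply: contraT => xr.
have : (n.+1 <= n)%N; last by rewrite ltnn.
apply: max_n; apply/asboolP; exists (x :: r); split=> /=.
- by rewrite xr.
- by move=> y /predU1P[-> // | /rP].
- by rewrite sz_r.
Qed.

(** * Fixed fields, and their interplay with the separable closure *)

Section FixedField.
Variables (K : fieldType) (L : fieldExtType K).
Implicit Types (F E M : {subfield L}) (x y : L) (s : 'End(L)).

Lemma sub_fixedG F : (F <= fixedG F)%VS.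
Proof.
apply/subvP=> x Fx; apply/fixedGP=> s.
by rewrite kAutfE => /kHomP_tmp[sF _]; apply: sF.
Qed.

Lemma sub_fixedG_sep_part F : (F <= fixedG F :&: sep_part F)%VS.
Proof. by rewrite subv_cap sub_fixedG sub_sep_part. Qed.

(** Every automorphism over [F] already fixes [E], so both groups coincide. *)
Lemma fixedG_id F E : (F <= E)%VS -> (E <= fixedG F)%VS -> fixedG E = fixedG F.
Proof.
move=> sFE sEG; apply/val_inj/eqP; rewrite eqEsubv; apply/andP; split.
  apply/subvP=> x /fixedGP xE; apply/fixedGP=> s sF; apply: xE.
  move: (sF); rewrite !kAutfE => /kHomP_tmp[_ sM]; apply/kHomP_tmp; split=> //.
  by move=> y /(subvP sEG)/fixedGP; apply.
apply/subvP=> x /fixedGP xF; apply/fixedGP=> s sE; apply: xF.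
exact: kAutS sE.
Qed.

(* The coefficients of the product of the [X - y], for [y] in the finite orbit
   of [x] under [G(L/F)], are invariant. *)
Lemma orbit_poly F x : exists r : seq L,
  [/\ uniq r, x \in r, all (root (minPoly F x)) r
    & \prod_(y <- r) ('X - y%:P) \is a polyOver (fixedG F)].
Proof.
pose orb y := exists2 s, kAut F {:L} s & s x = y.
have orb_root y : orb y -> root (minPoly F x) y.
  case=> s; rewrite kAutfE => sF <-.
  by rewrite (kHom_root_id (subvf F) sF) ?memvf ?minPolyOver ?root_minPoly.
have [r Ur rP] := enum_root_subset (monic_neq0 (monic_minPoly F x)) orb_root.
exists r; split=> //.
- by apply/rP; exists \1%VF; rewrite ?lfunE // kAutfE kHom1.
- by apply/allP=> y /rP/orb_root.
apply/polyOverP=> i; apply/fixedGP=> s; rewrite kAutfE => sF.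
have /kHom_monoid_morphism sM := kHomSl (sub1v F) sF.
pose sRM : {rmorphism L -> L} :=
  HB.pack (fun_of_lfun s) (GRing.isMonoidMorphism.Build _ _ _ sM).
rewrite -[LHS](coef_map sRM).
have -> : map_poly sRM (\prod_(y <- r) ('X - y%:P)) =
    \prod_(y <- map sRM r) ('X - y%:P).
  rewrite rmorph_prod big_map; apply: eq_bigr => y _.
  exact: (map_polyXsubC sRM).
congr ((_ : {poly L})`_i).
(* An injective map of a finite orbit into itself permutes it. *)
apply: perm_big; have Usr : uniq (map sRM r).
  by rewrite map_inj_uniq //; apply: fmorph_inj.
have sub_sr : {subset map sRM r <= r}.
  move=> _ /mapP[y /rP[t tF <-] ->]; apply/rP; exists (s \o t)%VF.
    by move: tF; rewrite !kAutfE; apply: comp_kHom.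
  by rewrite comp_lfunE.
apply: uniq_perm => //.
by have [] := uniq_min_size Usr sub_sr; rewrite ?size_map.
Qed.

Lemma separable_fixedG F x : separable_element (fixedG F) x.
Proof.
have [r [Ur xr _ Gr]] := orbit_poly F x.
apply/separable_elementP; exists (\prod_(y <- r) ('X - y%:P)).
by rewrite Gr root_prod_XsubC separable_prod_XsubC.
Qed.

(** Conjugates of a separable element are separable, so its orbit polynomial has coefficients in
    both fields and splits in [sep_part F]; the minimal polynomial divides it. *)
Lemma sep_part_galois F : galois_over (fixedG F :&: sep_part F)%AS (sep_part F).
Proof.
set E := (_ :&: _)%AS; have sFE : (F <= E)%VS := sub_fixedG_sep_part F.
split.
  by apply/separableP=> x; rewrite mem_sep_part; apply: separable_elementS.
move=> x Sx; have [r [Ur xr root_r Gr]] := orbit_poly F x.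
have sepx : separable_element F x by rewrite -mem_sep_part.
have rS : all [in sep_part F] r.
  apply/allP=> y /(allP root_r) root_y; rewrite /= mem_sep_part.
  apply/separable_elementP; exists (minPoly F x).
  by rewrite minPolyOver.
have Er : \prod_(y <- r) ('X - y%:P) \is a polyOver E.
  apply/polyOverP=> i; rewrite memv_cap (polyOverP Gr) /=.
  have /polyOverP-> // : \prod_(y <- r) ('X - y%:P) \is a polyOver (sep_part F).
  rewrite big_seq; apply: rpred_prod => y yr.
  by rewrite polyOverXsubC; apply: (allP rS).
have /dvdp_prod_XsubC[m Dm] : minPoly E x %| \prod_(y <- r) ('X - y%:P).
  by rewrite minPoly_dvdp // root_prod_XsubC.
exists (mask m r); first by apply/allP=> y /mem_mask/(allP rS).
by apply/eqP; rewrite -eqp_monic ?monic_minPoly ?monic_prod_XsubC.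
Qed.

Lemma fixedG_inseparable F :
  purely_inseparable (fixedG F :&: sep_part F)%AS (fixedG F).
Proof.
apply/purely_inseparableP=> x Gx; apply/purely_inseparable_elementP_pchar.
have [n chn Sxn] := exp_sep_part F x.
by exists n; rewrite // memv_cap rpredX.
Qed.

(** Roots of p-power order are unique: [s] fixes [x ^+ n], so [(s x - x) ^+ n = 0]. *)
Lemma inseparable_sub_fixedG E M : purely_inseparable E M -> (M <= fixedG E)%VS.
Proof.
move/purely_inseparableP=> insepM; apply/subvP=> x /insepM.
case/purely_inseparable_elementP_pchar=> n chn Exn; apply/fixedGP=> s.
rewrite kAutfE => sE; have [sid _] := kHomP_tmp sE.
have /kHom_monoid_morphism sM := kHomSl (sub1v E) sE.
pose sRM : {rmorphism L -> L} :=
  HB.pack (fun_of_lfun s) (GRing.isMonoidMorphism.Build _ _ _ sM).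
have sxn : s x ^+ n = x ^+ n by rewrite -[s x]/(sRM x) -rmorphXn /= sid.
apply/eqP; rewrite -subr_eq0; have : (s x - x) ^+ n == 0.
  by rewrite exprDn_pchar // exprNn_pchar // sxn subrr.
by rewrite expf_eq0 => /andP[].
Qed.

Lemma pi_part_fixedG F : pi_part (fixedG F :&: sep_part F)%AS = fixedG F.
Proof.
set E := (_ :&: _)%AS; have sFE : (F <= E)%VS := sub_fixedG_sep_part F.
have GE : fixedG E = fixedG F by rewrite (fixedG_id sFE) ?capvSl.
apply: is_largest_uniq (pi_partP E) _; split; first exact: capvSl.
  exact: fixedG_inseparable.
by move=> M _ /inseparable_sub_fixedG; rewrite GE.
Qed.

Lemma gal_part_sep_part F :
  gal_part (fixedG F :&: sep_part F)%AS = sep_part F.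
Proof.
set E := (_ :&: _)%AS; have sFE : (F <= E)%VS := sub_fixedG_sep_part F.
have SE : sep_part E = sep_part F by rewrite (sep_part_id sFE) ?capvSr.
apply: is_largest_uniq (gal_partP E) _; split; first exact: capvSr.
  exact: sep_part_galois.
by move=> M sEM [sepM _]; rewrite -SE; have [_ _ ->] := sep_partP E.
Qed.

(** Over the compositum each [x] is separable, thanks to [fixedG F], and purely inseparable, thanks
    to [sep_part F]. *)
Lemma prodv_fixedG_sep_part F : (fixedG F * sep_part F)%VS = {:L}%VS.
Proof.
pose P := (fixedG F * sep_part F)%AS; apply/vspaceP=> x; rewrite memvf.
have sGP : (fixedG F <= P)%VS by apply: field_subvMr.
have sSP : (sep_part F <= P)%VS by apply: field_subvMl.
rewrite -[LHS]/(x \in P) -separable_inseparable_element.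
rewrite (separable_elementS sGP (separable_fixedG F x)) /=.
apply/purely_inseparable_elementP_pchar.
by have [n chn /(subvP sSP) Pxn] := exp_sep_part F x; exists n.
Qed.

End FixedField.

(** * Normal forms in the tensor product, and bijectivity of multiplication *)

Section TensorDecomposition.
Variables (K : fieldType) (L : fieldExtType K) (M N : {subfield L}).
Let F : {subfield L} := (M :&: N)%AS.

(* The minimal polynomial of [x] over [M] is a product of factors [X - y] with
   [y] conjugate to [x], so its coefficients lie in [N]. *)
Lemma normal_minPoly_cap x : normal_over F N -> x \in N ->
  minPoly M x = minPoly F x.
Proof.
move=> nN Nx; have [r rN Dr] := nN x Nx.
have dvdMF : minPoly M x %| minPoly F x by apply: minPolyS; apply: capvSl.
have := dvdMF; rewrite {1}Dr => /dvdp_prod_XsubC[m].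
rewrite eqp_monic ?monic_minPoly ?monic_prod_XsubC // => /eqP Dm.
have FM : minPoly M x \is a polyOver F.
  apply/polyOverP=> i; rewrite memv_cap (polyOverP (minPolyOver M x)) /=.
  rewrite Dm; have /polyOverP-> // :
      \prod_(y <- mask m r) ('X - y%:P) \is a polyOver N.
  rewrite big_seq; apply: rpred_prod => y /mem_mask/(allP rN).
  by rewrite polyOverXsubC.
apply/eqP; rewrite -eqp_monic ?monic_minPoly // /eqp dvdMF.
by rewrite minPoly_dvdp ?root_minPoly.
Qed.

Notation teq := (@teq K L F M N).

Lemma teq_cons a s t : teq s t -> teq (a :: s) (a :: t).
Proof. exact: (teq_cat (teq_refl F [:: a])). Qed.

Lemma teq_catCA s a t : teq (s ++ a :: t) (a :: s ++ t).
Proof.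
rewrite -cat_rcons -cats1.
exact: (teq_cat (teq_catC F s [:: a]) (teq_refl F t)).
Qed.

(** The scalar 0 moves across the tensor sign, reducing this to [teq0]. *)
Lemma teqm0 m : teq [:: (m, 0)] [::].
Proof.
apply: (teq_trans _ (teq0 F M 0)); apply: teq_sym.
by apply: (@teqZ _ _ _ _ _ 0); rewrite ?mem0v ?mul0r.
Qed.

Lemma teq_sumr (I : Type) (r : seq I) m (n_ : I -> subvs_of N) :
  teq [:: (m, \sum_(i <- r) n_ i)] [seq (m, n_ i) | i <- r].
Proof.
elim: r => [|i r IHr]; first by rewrite big_nil; apply: teqm0.
by rewrite big_cons /=; apply: (teq_trans (teqDr _ _ _ _)); apply: teq_cons.
Qed.

(** Used to add two normal forms coefficientwise. *)
Lemma teq_merge (I : Type) (r : seq I) (m m' : I -> subvs_of M) n_ :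
  teq ([seq (m i, n_ i) | i <- r] ++ [seq (m' i, n_ i) | i <- r])
      [seq (m i + m' i, n_ i) | i <- r].
Proof.
elim: r => [|i r IHr] /=; first exact: teq_refl.
apply: (teq_trans (teq_cons _ (teq_catCA _ _ _))).
exact: (teq_cat (teq_sym (teqDl _ _ _ _)) IHr).
Qed.

Variables (t : L) (Nt : t \in N).
Hypothesis genN : (N <= <<F; t>>)%VS.
Hypothesis minPoly_t : minPoly M t = minPoly F t.

Let d := adjoin_degree F t.
Let basis i : subvs_of N := Subvs (rpredX i Nt).
(** The normal form of a tensor, expanded in powers of [t]; zero coefficients are kept, so all forms
    have the same shape. *)
Let normal (m : nat -> subvs_of M) := [seq (m i, basis i) | i <- iota 0 d].

(** Each right factor is a polynomial in [t] over [F]; its coefficients move to the left by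
    [teqZ]. *)
Lemma teq_normal (s : formal M N) : exists m, teq s (normal m).
Proof.
elim: s => [|[m n] s [m2 Ds]].
  exists (fun=> 0); rewrite /normal; elim: (iota 0 d) => [|i r IHr] /=.
    exact: teq_refl.
  exact: (teq_cat (teq_sym (teq0 _ _ _)) IHr).
have Fn : vsval n \in <<F; t>>%VS by apply: (subvP genN); apply: subvsP.
pose f := Fadjoin_poly F t (vsval n).
have Ff i : f`_i \in F by apply/polyOverP/Fadjoin_polyOver.
have Mf i : f`_i \in M by apply: (subvP (capvSl M N)).
have Nf i : f`_i \in N by apply: (subvP (capvSr M N)).
have Dn : n = \sum_(i <- iota 0 d) Subvs (Nf i) * basis i.
  apply: val_inj; rewrite /= -[LHS](Fadjoin_poly_eq Fn).
  rewrite (horner_coef_wide _ (size_Fadjoin_poly _ _ _)) linear_sum /=.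
  by rewrite -(big_mkord xpredT (fun i => f`_i * t ^+ i)) /index_iota subn0.
exists (fun i => Subvs (Mf i) * m + m2 i); rewrite -cat1s.
apply: (teq_trans _ (teq_merge _ _ _ _)); apply: teq_cat => //.
rewrite {1}Dn; apply: (teq_trans (teq_sumr _ _ _)).
elim: (iota 0 d) => [|i r IHr] /=; first exact: teq_refl.
apply: (teq_cat _ IHr (s1 := [:: _]) (t1 := [:: _])).
by apply: teq_sym; apply: (teqZ (Ff i)).
Qed.

(** By [minPoly_t], [t] has degree [d] over [M] too, so a polynomial over [M] with at most [d]
    coefficients is determined by its value at [t]. *)
Lemma formal_mul_normal_inj m m' :
  formal_mul (normal m) = formal_mul (normal m') -> normal m = normal m'.
Proof.
have Dmul m1 : formal_mul (normal m1) = (\poly_(i < d) vsval (m1 i)).[t].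
  rewrite /formal_mul /normal big_map horner_poly.
  by rewrite -(big_mkord xpredT (fun i => vsval (m1 i) * t ^+ i)) /index_iota subn0.
rewrite !Dmul => eq_mm'; pose q (m1 : nat -> subvs_of M) := \poly_(i < d) vsval (m1 i).
have Dd : d = adjoin_degree M t.
  by apply: succn_inj; rewrite -!size_minPoly minPoly_t.
have Mq m1 : q m1 \is a polyOver M.
  by apply/polyOverP=> i; rewrite coef_poly; case: ifP => _; rewrite ?mem0v ?subvsP.
have szq m1 : (size (q m1) <= adjoin_degree M t)%N by rewrite -Dd size_poly.
have eq_q : q m = q m'.
  rewrite -(Fadjoin_poly_unique (Mq m) (szq m) erefl).
  by rewrite -(Fadjoin_poly_unique (Mq m') (szq m') erefl) /q eq_mm'.
apply/eq_in_map => i; rewrite mem_iota /= add0n => lt_id.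
have /(congr1 (fun p : {poly L} => p`_i)) := eq_q.
by rewrite !coef_poly lt_id => /val_inj->.
Qed.

Lemma teq_formal_mul (s u : formal M N) : formal_mul s = formal_mul u -> teq s u.
Proof.
have [m Ds] := teq_normal s; have [m' Du] := teq_normal u.
rewrite (teq_mul Ds) (teq_mul Du) => /formal_mul_normal_inj Dmm'.
by apply: (teq_trans Ds); rewrite Dmm'; apply: teq_sym.
Qed.

End TensorDecomposition.

(** [M * N] is spanned by products of basis vectors; the scalars are absorbed in the left
    factors. *)
Lemma formal_mul_surj (K : fieldType) (L : fieldExtType K) (M N : {subfield L}) x :
  x \in (M * N)%VS -> exists s : formal M N, formal_mul s = x.
Proof.
rewrite [@prodv _ _]unlock => /coord_span->; set X := allpairs_tuple _ _ _.
suff Xs i : exists s : formal M N, formal_mul s = coord X i x *: X`_i.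
  have [s_ Ds] := choice Xs; exists (flatten [seq s_ i | i <- index_enum _]).
  rewrite /formal_mul big_flatten /= big_map; apply: eq_bigr => i _.
  exact: Ds.
have /allpairsP[[u v] /= [/vbasis_mem Mu /vbasis_mem Nv Di]] :
  X`_i \in allpairs *%R (vbasis M) (vbasis N) by apply: mem_nth; rewrite (size_tuple X).
exists [:: (coord X i x *: Subvs Mu, Subvs Nv)].
by rewrite /formal_mul big_seq1 /= Di scalerAl.
Qed.

Lemma galois_tensor_decomposition (K : fieldType) (L : fieldExtType K)
    (M N : {subfield L}) : galois_over (M :&: N)%AS N -> (M * N)%VS = {:L}%VS ->
  is_tensor_decomposition (M :&: N)%AS M N.
Proof.
move=> [sepN nN] MN; split; [exact: capvSl | exact: capvSr |].
set F := (M :&: N)%AS in sepN nN *.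
pose t := separable_generator F N.
have Nt : t \in N := separable_generator_mem N F.
have genN := sub_adjoin_separable_generator sepN.
have mp_t := normal_minPoly_cap nN Nt.
have mul_inj : injective (@tensor_mul K L F M N).
  move=> u v /(teq_formal_mul Nt genN mp_t) eq_uv.
  rewrite -[u]reprK -[v]reprK; apply/eqmodP.
  exact/asboolP.
have mul_surj x : exists u, @tensor_mul K L F M N u = x.
  have [|s Ds] := @formal_mul_surj _ _ M N x; first by rewrite MN memvf.
  by exists (\pi s)%qT; rewrite tensor_mul_pi.
have [g gK] := choice mul_surj.
by exists g => // u; apply: mul_inj; rewrite gK.
Qed.

Theorem corollary8p2 (K : fieldType) (p : nat) (charKp : p \in [pchar K])
    (L : fieldExtType K) :
  let LG : {subfield L} := fixedG 1%AS in
  let Ldif : {subfield L} := difField 1%AS in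
  let F : {subfield L} := (LG :&: Ldif)%AS in
  [/\ is_tensor_decomposition F (pi_part F) (gal_part F)
      /\ is_tensor_decomposition F LG Ldif,
      pi_part F = fixedG F /\ fixedG F = LG &
      [/\ gal_part F = sep_part F, sep_part F = difField F &
          difField F = Ldif]].
Proof.
rewrite /= !difField_sep_part; set F := (_ :&: _)%AS.
have sKF : (1 <= F)%VS := sub1v F.
(* [F] lies between [K] and each of the two fields, so passing from [K] to [F] changes neither. *)
have GF : fixedG F = fixedG 1 by rewrite (fixedG_id sKF) ?capvSl.
have SF : sep_part F = sep_part 1 by rewrite (sep_part_id sKF) ?capvSr.
have dec : is_tensor_decomposition F (fixedG 1) (sep_part 1).
  apply: galois_tensor_decomposition; first exact: sep_part_galois.
  exact: prodv_fixedG_sep_part.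
rewrite pi_part_fixedG gal_part_sep_part GF SF.
by split.
Qed.
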